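(* Let $q$ be a power of the prime $p$, let $m>1$ and $n=2$. Then the constant $$c=\sum_{a\in\mathbb F_q}\frac{|\widehat G{}^{a}_2|}{|\widehat G{}^{a}|}$$ equals $\frac q2$ if $p\neq 2$ and $\frac{q-1}{2}$ if $p=2$.
   Context: For $a\in\mathbb F_q$, let $G^{a}$ be the Galois group (automorphism group of the splitting field $K$) of $X^2-t(aX+1)$ over $\mathbb F_{q^m}(t)$, $t$ an indeterminate, regarded as a permutation group on the distinct roots (a subgroup of $\mathcal S_2$). Let $\mathbb F'$ be the algebraic closure of $\mathbb F_{q^m}$ in $K$, and for $\sigma\in G^{a}$ let $K_\sigma$ be the fixed field of $\sigma$ in $K$. Set $\widehat G{}^{a}=\{\sigma\in G^{a}: K_\sigma\cap\mathbb F'=\mathbb F_{q^m}\}$ and let $\widehat G{}^{a}_2$ be the set of elements of $\widehat G{}^{a}$ that act as a transposition (2-cycle) on two roots. *)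

(* Defs.v *)
From mathcomp Require Import all_boot all_order all_algebra.
From mathcomp Require Import all_fingroup all_field.
From mathcomp Require Import boolp classical_sets.

Set Implicit Arguments.
Unset Strict Implicit.
Unset Printing Implicit Defensive.

Import GRing.Theory.
Local Open Scope ring_scope.

Notation ratfun E := {fraction {poly E}}.

Definition tvar (E : fieldType) : ratfun E := tofrac 'X.

Definition ratfunC (E : fieldType) (c : E) : ratfun E := tofrac c%:P.

Definition fpoly (E : fieldType) (a : E) : {poly (ratfun E)} :=
  'X^2 - tvar E *: (ratfunC a *: 'X + 1).

Section SplittingField.

Variables (E : fieldType) (K : splittingFieldType (ratfun E)).

Definition fpolyK (a : E) : {poly K} := map_poly (in_alg K) (fpoly a).

Definition is_splitting_field (a : E) : Prop :=
  splittingFieldFor 1%VS (fpolyK a) {:K}%VS.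

(* When fpoly a is inseparable, K is not Galois over E(t), but 'Gal({:K} / 1)
   is still the group of all automorphisms of K over E(t). *)
Definition Ggrp : {set gal_of {:K}%AS} := 'Gal({:K} / 1)%g.

Definition constK (c : E) : K := in_alg K (ratfunC c).

Definition alg_constants : set K := [set x | algebraicOver constK x]%classic.

Definition fixed_by (s : gal_of {:K}%AS) : {vspace K} := fixedField [set s].

Definition Ghat : {set gal_of {:K}%AS} :=
  [set s in Ggrp |
    `[< ([set` fixed_by s] `&` alg_constants = range constK)%classic >]].

(* s induces a 2-cycle on the set of distinct roots of fpoly a in K. *)
Definition acts_as_transposition (a : E) (s : gal_of {:K}%AS) : Prop :=
  exists x y : K,
    [/\ x != y, root (fpolyK a) x, root (fpolyK a) y,
        (s x = y) /\ (s y = x) &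
        forall z : K, root (fpolyK a) z -> z != x -> z != y -> s z = z].

Definition Ghat2 (a : E) : {set gal_of {:K}%AS} :=
  [set s in Ghat | `[< acts_as_transposition a s >]].

End SplittingField.

Definition cycle_constant (k : finFieldType) (E : fieldType) (iota : k -> E)
    (K : k -> splittingFieldType (ratfun E)) : rat :=
  \sum_(a : k) #|Ghat2 (K a) (iota a)|%:R / #|Ghat (K a)|%:R.

(* Main.v *)
(* If x is a root of X^2 - t(aX + 1), then t = x^2 / (ax + 1), so K = F(t, x) is
   the rational function field F(x) over the constant field F. Hence F is
   algebraically closed in K and every element of the Galois group G lies in
   Ghat. Since x is not in F(t), G has order 2 and its nontrivial element swaps
   the two roots, unless the roots coincide, which happens only in
   characteristic 2 with a = 0. *)
Require Import Defs.
From mathcomp Require Import all_boot all_order all_algebra.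
From mathcomp Require Import all_fingroup all_field.
From mathcomp Require Import boolp ring.

Set Implicit Arguments.
Unset Strict Implicit.
Unset Printing Implicit Defensive.

Import GRing.Theory.
Local Open Scope ring_scope.

(** * Fractions of polynomials and a descent on [X] *)

Lemma fraction_numden (R : idomainType) (r : {fraction R}) :
  exists u v : R, v != 0 /\ r * tofrac v = tofrac u.
Proof.
elim/quotW: r => z; exists z.1, z.2; split; first exact: denom_ratioP.
(* Exposing [FracField.mul] lets the equality be checked on representatives. *)
change (FracField.mul (\pi_({fraction R})%qT z) (tofrac z.2) = tofrac z.1).
apply/eqP; rewrite !piE.
by rewrite FracField.equivfE /FracField.mulf !numden_Ratio ?mulf_neq0 ?oner_neq0
  ?denom_ratioP ?mulr1 //= mulrC.
Qed.

(** Infinite descent: [X] divides [f], hence also [g], and the quotients by [X] satisfy the same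
    equation with a denominator of smaller size. *)
Lemma sqr_eq_mulX (E : fieldType) (a : E) (f g : {poly E}) :
  f ^+ 2 = 'X * (a *: f * g + g ^+ 2) -> g = 0.
Proof.
have dvdX (h k : {poly E}) : h ^+ 2 = k * 'X -> exists h1, h = h1 * 'X.
  move=> hk; suff /factor_theorem[h1 ->] : root h 0 by rewrite subr0; exists h1.
  by rewrite /root -sqrf_eq0 -horner_exp hk hornerMX mulr0.
have X0 : 'X != 0 :> {poly E} by rewrite polyX_eq0.
have [n] := ubnP (size g); elim: n => // n IHn in f g *.
move=> sg fg; have [f1 f1E] : exists f1, f = f1 * 'X.
  by apply: dvdX; rewrite fg mulrC.
have fg1 : g ^+ 2 = (f1 ^+ 2 - a *: f1 * g) * 'X.
  apply: (mulfI X0); move: fg; rewrite f1E -!mul_polyC => fg.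
  ring: fg.
have [g1 g1E] := dvdX _ _ fg1.
have [g10|g1N0] := eqVneq g1 0; first by rewrite g1E g10 mul0r.
rewrite g1E (IHn f1 g1) ?mul0r //; first by rewrite g1E size_mulX in sg.
by apply: (mulfI X0); apply: (mulfI X0); move: fg1;
  rewrite g1E -!mul_polyC => fg1; ring: fg1.
Qed.

(** * The subfield [E(x)] and its algebraic elements *)

Section RationalValue.

Variables (E L : fieldType) (phi : {rmorphism E -> L}) (x : L).

(** Membership in the subfield generated by [phi E] and [x], in a form that also suits a
    transcendental [x]. *)
Definition rational_value (y : L) : Prop :=
  exists f g : {poly E}, (map_poly phi g).[x] != 0 /\
    y * (map_poly phi g).[x] = (map_poly phi f).[x].

Lemma rational_value_const (c : E) : rational_value (phi c).
Proof.
by exists c%:P, 1; rewrite rmorph1 map_polyC !hornerC oner_neq0 mulr1.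
Qed.

Lemma rational_value_id : rational_value x.
Proof.
by exists 'X, 1; rewrite rmorph1 map_polyX hornerX hornerC oner_neq0 mulr1.
Qed.

Lemma rational_valueD (y z : L) :
  rational_value y -> rational_value z -> rational_value (y + z).
Proof.
move=> [f [g [g0 yE]]] [h [k [k0 zE]]]; exists (f * k + h * g), (g * k).
rewrite rmorphD !rmorphM hornerD !hornerM mulf_neq0 // -yE -zE; split=> //.
by ring.
Qed.

Lemma rational_valueM (y z : L) :
  rational_value y -> rational_value z -> rational_value (y * z).
Proof.
move=> [f [g [g0 yE]]] [h [k [k0 zE]]]; exists (f * h), (g * k).
by rewrite !rmorphM !hornerM mulf_neq0 // -yE -zE mulrACA.
Qed.

Lemma rational_value_div (y z w : L) :
  rational_value y -> rational_value z -> z != 0 -> w * z = y -> rational_value w.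
Proof.
move=> [f [g [g0 yE]]] [h [k [k0 zE]]] z0 wE; exists (f * k), (g * h).
rewrite !rmorphM !hornerM -yE -zE -wE !mulf_neq0 //; split=> //.
by ring.
Qed.

Lemma rational_value_horner (p : {poly L}) (y : L) :
  (forall i, rational_value p`_i) -> rational_value y -> rational_value p.[y].
Proof.
move=> Rp Ry; rewrite -[p]coefK horner_poly.
have R0 : rational_value 0 by rewrite -(rmorph0 phi); apply: rational_value_const.
have R1 : rational_value 1 by rewrite -(rmorph1 phi); apply: rational_value_const.
apply: (big_ind rational_value) => // [|i _]; first exact: rational_valueD.
apply: rational_valueM => //; elim: (i : nat) => [|n IHn]; first by rewrite expr0.
by rewrite exprS; apply: rational_valueM.
Qed.

(* If y = f(x)/g(x) is not in E, then x is a root of the nonzero polynomial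
   f - y g over E(y), so x is algebraic over E as soon as y is. *)
Lemma rational_value_algebraic (y : L) : ~ algebraicOver phi x ->
  rational_value y -> algebraicOver phi y -> exists c, y = phi c.
Proof.
move=> trx [f [g [g0 yE]]] algy.
(* The outer variable of [P] stands for [y], the inner one for [x]. *)
pose P : {poly {poly E}} := f%:P - g *: 'X.
have PE : (map_poly (map_poly phi) P).[y%:P] = map_poly phi f - y *: map_poly phi g.
  rewrite rmorphB /= map_polyC map_polyZ map_polyX /= hornerD hornerN hornerZ.
  by rewrite hornerX hornerC mulrC mul_polyC.
have [fg0|fgN0] := eqVneq (map_poly phi f - y *: map_poly phi g) 0; last first.
  case: trx; apply: (algebraic_root_polyXY _ algy); exists P; rewrite PE //.
  by rewrite /root hornerD hornerN hornerZ -yE subrr.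
have gN0 : g != 0 by apply: contraNneq g0 => ->; rewrite rmorph0 horner0.
(* Now [f = y g] as polynomials over [L]; the coefficients at the degree of [g] give the
   constant. *)
exists (f`_(size g).-1 / lead_coef g); rewrite fmorph_div.
have /(congr1 (coefp (size g).-1)) := fg0; rewrite /= coefB coefZ !coef_map coef0.
move/eqP; rewrite subr_eq0 => /eqP->.
by rewrite mulfK // fmorph_eq0 lead_coef_eq0.
Qed.

End RationalValue.

(** * Galois group of a separable quadratic *)

(** Distinct roots make the extension Galois; its degree is that of [x], which is at most 2 because
    the minimal polynomial divides [p], and is not 1. *)
Lemma Gal_quadratic (F : fieldType) (L : splittingFieldType F) (p : {poly F})
    (x y : L) :
  map_poly (in_alg L) p = ('X - x%:P) * ('X - y%:P) ->
  <<1; x>>%VS = {:L}%VS -> x \notin 1%VS -> x != y ->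
  exists s : gal_of {:L}%AS,
    [/\ 'Gal({:L} / 1)%g = [set 1%g; s], s != 1%g, s x = y & s y = x].
Proof.
move=> pE Lx xN1 xy; have p1 := @alg_polyOver _ L 1%AS p.
have sep : galois 1%AS {:L}%AS.
  apply/splitting_galoisField; exists (map_poly (in_alg L) p).
  have pE' : map_poly (in_alg L) p = \prod_(z <- [:: x; y]) ('X - z%:P).
    by rewrite pE !big_cons big_nil mulr1.
  split=> //; first by rewrite pE' separable_prod_XsubC /= inE xy.
  exists [:: x; y]; first by rewrite pE' eqpxx.
  apply/eqP; rewrite eqEsubv subvf /= -Lx.
  by apply/FadjoinP; rewrite sub1v seqv_sub_adjoin ?mem_head.
have cG : #|'Gal({:L} / 1)%g| = 2%N.
  rewrite -(galois_dim sep) /= -Lx dim_Fadjoin dimv1 muln1 divn1.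
  have le2 : (adjoin_degree 1 x <= 2)%N.
    rewrite -ltnS -size_minPoly.
    have ->: 3%N = size (('X - x%:P) * ('X - y%:P)).
      by rewrite size_mul ?polyXsubC_eq0 // !size_XsubC.
    rewrite dvdp_leq ?mulf_neq0 ?polyXsubC_eq0 // minPoly_dvdp -?pE //.
    by rewrite pE rootM root_XsubC eqxx.
  have := adjoin_deg_eq1 1%AS x; rewrite (negPf xN1).
  by move: le2; rewrite /adjoin_degree; case: _.-1 => [|[|]].
have := cG; rewrite (cardsD1 1%g) group1 => -[] /eqP/cards1P[s sE].
have: s \in 'Gal({:L} / 1)%g :\ 1%g by rewrite sE set11.
rewrite !inE => /andP[s1 Gs]; exists s.
have sxy z : root (map_poly (in_alg L) p) z -> s z = x \/ s z = y.
  move=> pz; have: root (map_poly (in_alg L) p) (s z).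
    by rewrite -(fixedPoly_gal (sub1v _) Gs p1) fmorph_root.
  by rewrite pE rootM !root_XsubC => /orP[]/eqP; [left | right].
have sx : s x = y.
  case: (sxy x) => //; first by rewrite pE rootM root_XsubC eqxx.
  (* Since [x] generates [L], fixing [x] would make [s] the identity. *)
  move=> sx; case/eqP: s1; apply/eqP/gal_eqP => z _.
  have: z \in <<1; x>>%VS by rewrite Lx memvf.
  case/Fadjoin1_polyP=> h ->; rewrite gal_id -horner_map /= sx.
  by rewrite (fixedPoly_gal (sub1v _) Gs (@alg_polyOver _ L 1%AS h)).
split=> //; first by rewrite -sE setD1K ?group1.
case: (sxy y) => //; first by rewrite pE rootM !root_XsubC eqxx orbT.
by rewrite -{2}sx => /fmorph_inj yx; rewrite yx eqxx in xy.
Qed.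

(** * The splitting field of [X^2 - t(aX + 1)] *)

Section SplittingFieldOfFpoly.

Variables (E : fieldType) (K : splittingFieldType (ratfun E)) (a : E).

(** This is [constK] packaged as a ring morphism. *)
Let C : {rmorphism E -> K} := in_alg K \o @tofrac {poly E} \o polyC.
Let t : K := in_alg K (tvar E).

Lemma fpolyK_expand : fpolyK K a = 'X^2 - t *: (C a *: 'X + 1).
Proof.
rewrite /fpolyK /fpoly rmorphB /= map_polyXn map_polyZ rmorphD /= map_polyZ.
by rewrite map_polyX rmorph1.
Qed.

(** Evaluation at [t] is the embedding of [E[t]] into [K]; its injectivity yields the transcendence
    of [t]. *)
Lemma horner_constK_tvar (p : {poly E}) :
  (map_poly C p).[t] = in_alg K (tofrac p).
Proof.
have ->: map_poly C p =
    map_poly (in_alg K) (map_poly (@tofrac {poly E}) (map_poly polyC p)).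
  by apply/polyP=> i; rewrite !coef_map.
by rewrite !horner_map [_.['X]]comp_polyXr.
Qed.

Lemma tvar_transcendental : ~ algebraicOver C t.
Proof.
case=> p pN0; rewrite /root horner_constK_tvar fmorph_eq0 tofrac_eq0.
by rewrite (negPf pN0).
Qed.

Lemma root_fpolyK x : root (fpolyK K a) x -> x ^+ 2 = t * (C a * x + 1).
Proof.
by rewrite /root fpolyK_expand !hornerE subr_eq0 => /eqP.
Qed.

(** A vanishing denominator would force [x = 0], and then [1 = 0]. This justifies solving the
    equation for [t]. *)
Lemma root_fpolyK_neq0 x : root (fpolyK K a) x -> C a * x + 1 != 0.
Proof.
move/root_fpolyK=> xE; apply/eqP=> ax0; move/eqP: xE.
rewrite ax0 mulr0 sqrf_eq0 => /eqP x0; move/eqP: ax0.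
by rewrite x0 mulr0 add0r oner_eq0.
Qed.

Lemma root_fpolyK_transcendental x :
  root (fpolyK K a) x -> ~ algebraicOver C x.
Proof.
move=> rx algx; apply: tvar_transcendental.
have ->: t = x ^+ 2 / (C a * x + 1).
  by rewrite (root_fpolyK rx) mulfK // root_fpolyK_neq0.
apply: algebraic_div; first exact: algebraic_mul.
apply: algebraic_add; last exact: algebraic1.
by apply: algebraic_mul => //; apply: algebraic_id.
Qed.

(** An element of [E(t)(x)] is a polynomial in [x] with coefficients in [E(t)], and [t] is itself a
    fraction in [x]. *)
Lemma root_fpolyK_rational_value x z : root (fpolyK K a) x ->
  z \in <<1; x>>%VS -> rational_value C x z.
Proof.
move=> rx.
have Rt : rational_value C x t.
  apply: (rational_value_div (y := x ^+ 2) (z := C a * x + 1)).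
  - by apply: rational_valueM; apply: rational_value_id.
  - apply: rational_valueD; last first.
      by rewrite -(rmorph1 C); apply: rational_value_const.
    apply: rational_valueM; first exact: rational_value_const.
    exact: rational_value_id.
  - exact: root_fpolyK_neq0.
  - by rewrite (root_fpolyK rx).
have Rp (p : {poly E}) : rational_value C x (in_alg K (tofrac p)).
  rewrite -horner_constK_tvar; apply: rational_value_horner => // i.
  by rewrite coef_map; apply: rational_value_const.
case/Fadjoin1_polyP=> p ->; apply: rational_value_horner => [i|]; last first.
  exact: rational_value_id.
rewrite coef_map; have [u [v [v0 uv]]] := fraction_numden p`_i.
apply: (rational_value_div (Rp u) (Rp v)).
  by rewrite fmorph_eq0 tofrac_eq0.
by rewrite -[LHS](rmorphM (in_alg K)) uv.
Qed.

(** Clearing denominators in a root [f/g] gives the equation of [sqr_eq_mulX], which forces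
    [g = 0]. *)
Lemma root_fpolyK_notin1 x : root (fpolyK K a) x -> x \notin 1%VS.
Proof.
move=> rx; apply/vlineP=> -[r xr]; have xE := root_fpolyK rx.
have /fmorph_inj : in_alg K (r ^+ 2) = in_alg K (tvar E * (ratfunC a * r + 1)).
  by rewrite rmorphXn rmorphM rmorphD rmorphM rmorph1; move: xE; rewrite xr.
have [f [g [g0 fg]]] := fraction_numden r => rE.
have : f ^+ 2 = 'X * (a *: f * g + g ^+ 2).
  apply/eqP; rewrite -tofrac_eq -mul_polyC !(tofracM, tofracD, tofracXn) -fg.
  by rewrite exprMn rE /tvar /ratfunC; apply/eqP; ring.
by move/sqr_eq_mulX=> g00; rewrite g00 eqxx in g0.
Qed.

Hypothesis splitK : is_splitting_field K a.

Lemma fpolyK_factor : exists x y : K,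
  [/\ fpolyK K a = ('X - x%:P) * ('X - y%:P),
      x + y = t * C a & <<1; x>>%VS = {:K}%VS].
Proof.
have [rs fE Krs] := splitK.
have sf : size (fpolyK K a) = 3%N.
  rewrite fpolyK_expand size_polyDl ?size_polyXn //.
  rewrite size_polyN (leq_ltn_trans (size_scale_leq _ _)) // ltnS.
  rewrite (leq_trans (size_polyD _ _)) // geq_max size_poly1 andbT.
  by rewrite (leq_trans (size_scale_leq _ _)) // size_polyX.
have mf : fpolyK K a \is monic.
  by rewrite monicE lead_coefE sf fpolyK_expand !coefE /= mulr0 addr0 mulr0 subr0.
(* The size 3 leaves exactly two entries in the list of roots. *)
have := eqp_size fE; rewrite sf size_prod_XsubC => -[].
case: rs fE Krs => [|x [|y []]] // fE Krs _.
(* The given factorization holds up to a scalar, which is 1 because both sides are monic. *)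
have {}fE : fpolyK K a = ('X - x%:P) * ('X - y%:P).
  move: fE; rewrite eqp_monic ?monic_prod_XsubC // => /eqP->.
  by rewrite !big_cons big_nil mulr1.
have xyE : x + y = t * C a.
  have := congr1 (coefp 1) fE; rewrite fpolyK_expand /= mulrBr !mulrBl.
  rewrite -!polyCM !coefE /=.
  by rewrite !mulr1 mul1r addr0 subr0 !sub0r -opprD => /oppr_inj->.
exists x, y; split=> //.
apply/eqP; rewrite eqEsubv subvf /= -Krs.
apply/Fadjoin_seqP; split=> [|z]; first exact: subv_adjoin.
have xx := memv_adjoin 1 x.
rewrite !inE => /orP[]/eqP-> //.
(* The sum of the roots lies in the base field, so adjoining [x] also gives [y]. *)
have ->: y = t * C a - x by rewrite -xyE addrC addKr.
rewrite rpredB // (subvP (subv_adjoin _ _)) //= rpredM //; exact: memvZ (mem1v _).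
Qed.

Lemma algebraic_constK z : algebraicOver (constK K) z ->
  exists c, z = constK K c.
Proof.
have [x [y [fE _ Kx]]] := fpolyK_factor => algz.
have rx : root (fpolyK K a) x by rewrite fE rootM root_XsubC eqxx.
apply: (@rational_value_algebraic _ _ C x z) => //.
  exact: root_fpolyK_transcendental.
by apply: root_fpolyK_rational_value; rewrite ?Kx ?memvf.
Qed.

(** The algebraic elements of [K] are the constants alone, and every automorphism over [E(t)] fixes
    them. *)
Lemma GhatE : Ghat K = Ggrp K.
Proof.
apply/setP=> s; rewrite inE; case Gs: (s \in Ggrp K) => //=.
apply/asboolP/classical_sets.seteqP; split=> [z|_ [c _ <-]].
  by case=> _ /algebraic_constK[c ->]; exists c.
split; last exact: (algebraic_id C).
apply/fixedFieldP; first exact: memvf.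
move=> u; rewrite inE => /eqP->; apply: (fixed_gal (sub1v _) Gs).
exact: memvZ (mem1v _).
Qed.

(** The hypothesis guarantees distinct roots; the group then has two elements, of which only the
    swap is a transposition. *)
Lemma Ghat_ratio : (1 + 1 != 0 :> E) || (a != 0) ->
  #|Ghat2 K a|%:R / #|Ghat K|%:R = 1 / 2%:R :> rat.
Proof.
move=> sepa; have [x [y [fE xyD Kx]]] := fpolyK_factor.
have rE z : root (fpolyK K a) z = (z == x) || (z == y).
  by rewrite fE rootM !root_XsubC.
have rx : root (fpolyK K a) x by rewrite rE eqxx.
have xy : x != y.
  (* A double root satisfies [2x = ta]. If 2 is invertible, [x] lies in [E(t)], which is excluded;
     otherwise [ta = 0], hence [a = 0]. *)
  apply: contraTneq sepa => xy; rewrite negb_or !negbK.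
  have /eqP a20 : (1 + 1) == 0 :> E.
    apply: contraLR (root_fpolyK_notin1 rx) => C2; rewrite negbK.
    have {}C2 : C (1 + 1) != 0 by rewrite fmorph_eq0.
    have ->: x = t * (C a / C (1 + 1)).
      apply: (mulIf C2); rewrite mulrA divfK // -xyD -xy rmorphD rmorph1.
      by rewrite mulrDr mulr1.
    by rewrite !rpredM ?rpredV //; exact: memvZ (mem1v _).
  rewrite a20 eqxx /=.
  have : t * C a = C (1 + 1) * x.
    by rewrite -xyD -xy rmorphD rmorph1 mulrDl mul1r.
  rewrite a20 rmorph0 mul0r => /eqP.
  rewrite mulf_eq0 (fmorph_eq0 C a) => /orP[/eqP t0|//].
  by case: tvar_transcendental; rewrite t0; apply: algebraic0.
have [s [GE s1 sx sy]] := Gal_quadratic fE Kx (root_fpolyK_notin1 rx) xy.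
rewrite GhatE /Ggrp GE cards2 eq_sym s1.
suff ->: Ghat2 K a = [set s] by rewrite cards1.
apply/setP=> u; rewrite /Ghat2 GhatE /Ggrp GE !inE.
have [->|us] := eqVneq u s.
  rewrite orbT /=; apply/asboolP; exists x, y; split; rewrite ?rE ?eqxx ?orbT //.
  by move=> z; rewrite rE => /orP[]/eqP->; rewrite eqxx.
rewrite orbF; have [->|//] := eqVneq u 1%g.
apply/asboolP=> -[x' [y' [xy' _ _ [x'y _] _]]].
by rewrite gal_id in x'y; rewrite x'y eqxx in xy'.
Qed.

(** Here [x + y = ta = 0], so [x = y] in characteristic 2 and there are no two roots to swap. *)
Lemma Ghat2_inseparable : 1 + 1 = 0 :> E -> a = 0 -> Ghat2 K a = set0.
Proof.
move=> E2 a0; have [x [y [fE xyD _]]] := fpolyK_factor.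
have xy : x = y.
  have C2 : (1 + 1 : K) = 0 by rewrite -(rmorph1 C) -rmorphD E2 rmorph0.
  apply/eqP; rewrite -subr_eq0; apply/eqP.
  have ->: x - y = x + y - (1 + 1) * y by ring.
  by rewrite xyD a0 rmorph0 C2 mulr0 mul0r subr0.
apply/setP=> s; rewrite !inE; apply/negP=> /andP[_ /asboolP].
case=> x' [y' [xy']]; rewrite fE -xy !rootM !root_XsubC !orbb.
by move=> /eqP x'x /eqP y'x; rewrite x'x y'x eqxx in xy'.
Qed.

End SplittingFieldOfFpoly.

(** * Summation over [a] *)

Theorem theorem4p6 (p e q m : nat) (hp : prime p) (he : (0 < e)%N)
    (hq : q = (p ^ e)%N) (hm : (1 < m)%N)
    (Fq Fqm : finFieldType) (cardFq : #|Fq| = q) (cardFqm : #|Fqm| = (q ^ m)%N)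
    (iota : {rmorphism Fq -> Fqm})
    (K : Fq -> splittingFieldType (ratfun Fqm))
    (hK : forall a : Fq, is_splitting_field (K a) (iota a)) :
  (p <> 2%N -> cycle_constant iota K = q%:R / 2%:R) /\
  (p = 2%N -> cycle_constant iota K = (q%:R - 1) / 2%:R).
Proof.
have chp : p \in [pchar Fqm].
  by apply: (@card_finPcharP _ p (e * m)); rewrite // cardFqm hq expnM.
have two0 : (1 + 1 == 0 :> Fqm) = (p == 2%N).
  by rewrite -[1 + 1]/(2%:R) -(dvdn_pcharf chp) dvdn_prime2.
rewrite /cycle_constant; split=> [/eqP p2|p2].
  under eq_bigr => a _ do rewrite (Ghat_ratio (hK a)) ?two0 ?p2 //.
  by rewrite sumr_const -[#|_|]/(#|Fq|) cardFq -(mulr_natl (1 / 2%:R)) mulrA mulr1.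
(* For [p = 2] the term at [a = 0] vanishes; each of the other [q - 1] terms is [1/2]. *)
rewrite (bigD1 0) //= (Ghat2_inseparable (hK 0)) ?rmorph0 //; last first.
  by apply/eqP; rewrite two0 p2.
rewrite cards0 mul0r add0r.
under eq_bigr => a a0 do rewrite (Ghat_ratio (hK a)) ?fmorph_eq0 ?a0 ?orbT //.
rewrite sumr_const cardC1 cardFq -(mulr_natl (1 / 2%:R)) mulrA mulr1 -subn1 natrB //.
(* Positivity of [q] makes the truncated subtraction [q - 1] agree with the rational one. *)
by rewrite hq expn_gt0 prime_gt0.
Qed.
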